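(* Let $\gamma:I\to G_3^1$ be a Frenet curve of osculating order $3$ in the equiform geometry of the pseudo-Galilean space $G_3^1$, with equiform curvature $\mathcal{K}$ and equiform torsion $\mathcal{T}$. Then $\gamma$ is of type equiform AW$(2)$ if and only if $$\mathcal{K}^2\mathcal{T}-\mathcal{K}\mathcal{T}'+\mathcal{T}\mathcal{K}'-\mathcal{T}^3=0,$$ where $'$ on $\mathcal{K},\mathcal{T}$ denotes the derivative with respect to the equiform parameter $\sigma$.
   Context: Pseudo-Galilean space. $G_3^1$ is $\mathbb{R}^3$ with the scalar product $\langle u,v\rangle=u_1v_1$ if $u_1\neq0$ or $v_1\neq 0$, and $\langle u,v\rangle=u_2v_2-u_3v_3$ if $u_1=v_1=0$. Curves. Curves are sufficiently smooth admissible curves (no inflection points, no isotropic tangents, no lightlike principal normals), parametrized by arc length $s=x$: $\gamma(s)=(s,y(s),z(s))$ with $y''(s)\neq\pm z''(s)$ for all $s$ in an interval $I$. The curvature and torsion are $\kappa=\sqrt{|y''^2-z''^2|}>0$ and $\tau=(y''z'''-y'''z'')/\kappa^2$. The trihedron is $\mathbf{e}_1=(1,y',z')$, $\mathbf{e}_2=\frac1\kappa(0,y'',z'')$, $\mathbf{e}_3=\frac1\kappa(0,\epsilon z'',\epsilon y'')$, where $\epsilon=\pm1$ satisfies $|y''^2-z''^2|=\epsilon(y''^2-z''^2)$. It satisfies $\mathbf{e}_1'=\kappa\mathbf{e}_2$, $\mathbf{e}_2'=\tau\mathbf{e}_3$, $\mathbf{e}_3'=\tau\mathbf{e}_2$.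 Equiform geometry. Let $\rho=1/\kappa$. The equiform parameter is $\sigma=\int\kappa\,ds$. The equiform frame is $\mathbf{T}=\rho\mathbf{e}_1$, $\mathbf{N}=\rho\mathbf{e}_2$, $\mathbf{B}=\rho\mathbf{e}_3$. The equiform curvature is $\mathcal{K}=d\rho/ds$ and the equiform torsion is $\mathcal{T}=\rho\tau=\tau/\kappa$. Below, $\mathcal{K}'=d\mathcal{K}/d\sigma$ and $\mathcal{T}'=d\mathcal{T}/d\sigma$. Osculating order. A Frenet curve of osculating order $3$ is a curve for which the $s$-derivatives $\gamma',\gamma'',\gamma'''$ are linearly independent and $\gamma',\gamma'',\gamma''',\gamma''''$ are no longer linearly independent, for all $s\in I$. AW(2) type. Put $Q_2=\frac1{\rho^3}(-\mathcal{K}\mathbf{N}+\mathcal{T}\mathbf{B})$ and $Q_3=\frac1{\rho^4}[(2\mathcal{K}^2+\mathcal{T}^2-\mathcal{K}')\mathbf{N}+(\mathcal{T}'-3\mathcal{K}\mathcal{T})\mathbf{B}]$. Write $\|v\|^2=\langle v,v\rangle$. A Frenet curve of osculating order $3$ is of type equiform AW$(2)$ if $\|Q_2\|^2Q_3=\langle Q_3,Q_2\rangle Q_2$ for all $s\in I$. *)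

(* Defs.v *)
From HB Require Import structures.
From mathcomp Require Import all_boot all_order all_algebra.
From mathcomp Require Import all_classical all_reals all_analysis.

Set Implicit Arguments.
Unset Strict Implicit.
Unset Printing Implicit Defensive.

Import Order.TTheory GRing.Theory Num.Theory.
Import numFieldNormedType.Exports.

Local Open Scope ring_scope.
Local Open Scope classical_set_scope.

(* In [ring_scope] these notations would denote derivatives of polynomials. *)
Local Notation "f ^` ()" := (derive1 f) : ring_scope.
Local Notation "f ^` ( n )" := (derive1n n f) : ring_scope.

(* Vectors of R^3 are row vectors; the coordinates u_1, u_2, u_3 are
   [u 0 0], [u 0 1], [u 0 2%:R]. *)
Definition vec3 (R : realType) (a b c : R) : 'rV[R]_3 :=
  \row_i [:: a; b; c]`_i.

Definition pg_dot (R : realType) (u v : 'rV[R]_3) : R :=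
  if (u 0 0 != 0) || (v 0 0 != 0) then u 0 0 * v 0 0
  else u 0 1 * v 0 1 - u 0 2%:R * v 0 2%:R.

Definition pg_normsq (R : realType) (v : 'rV[R]_3) : R := pg_dot v v.

(* [f] is of class C^n in a neighbourhood of every point of [I]. When the
   interval [I] is open this is ordinary C^n regularity on [I]; at an endpoint
   belonging to [I] it says that [f] has a C^n extension, so that the two-sided
   derivatives below make sense there. *)
Definition Cn_on (R : realType) (n : nat) (I : set R) (f : R -> R) : Prop :=
  forall s, I s -> \forall t \near s,
    (forall k, (k < n)%N -> derivable f^`(k) t 1) /\
    {for t, continuous f^`(n)}.

(* The derivative df/dp of [f] with respect to the parameter [p], at the point
   of parameter value [p s]. *)
Definition derive_wrt (R : realType) (p f : R -> R) (s : R) : R :=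
  lim ((fun t => (f t - f s) / (p t - p s)) @ s^').

Section PseudoGalileanCurve.
Variables (R : realType) (y z : R -> R).

Definition pg_curve (s : R) : 'rV[R]_3 := vec3 s (y s) (z s).

Definition admissible_on (I : set R) : Prop :=
  forall s, I s -> y^`(2) s <> z^`(2) s /\ y^`(2) s <> - z^`(2) s.

Definition pg_curvature (s : R) : R :=
  Num.sqrt `|y^`(2) s ^+ 2 - z^`(2) s ^+ 2|.

Definition pg_torsion (s : R) : R :=
  (y^`(2) s * z^`(3) s - y^`(3) s * z^`(2) s) / pg_curvature s ^+ 2.

(* For an admissible curve this is the only number e in {1, -1} such that
   |y''^2 - z''^2| = e (y''^2 - z''^2). *)
Definition pg_sign (s : R) : R := Num.sg (y^`(2) s ^+ 2 - z^`(2) s ^+ 2).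

Definition frame_e1 (s : R) : 'rV[R]_3 := vec3 1 (y^`() s) (z^`() s).

Definition frame_e2 (s : R) : 'rV[R]_3 :=
  (pg_curvature s)^-1 *: vec3 0 (y^`(2) s) (z^`(2) s).

Definition frame_e3 (s : R) : 'rV[R]_3 :=
  (pg_curvature s)^-1 *:
    vec3 0 (pg_sign s * z^`(2) s) (pg_sign s * y^`(2) s).

Definition radius (s : R) : R := (pg_curvature s)^-1.

(* The equiform parameter is an indefinite integral of the curvature: it is
   determined up to an additive constant. *)
Definition equiform_parameter (I : set R) (sigma : R -> R) : Prop :=
  forall s, I s -> is_derive s 1 sigma (pg_curvature s).

Definition equiform_T (s : R) : 'rV[R]_3 := radius s *: frame_e1 s.
Definition equiform_N (s : R) : 'rV[R]_3 := radius s *: frame_e2 s.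
Definition equiform_B (s : R) : 'rV[R]_3 := radius s *: frame_e3 s.

Definition equiform_curvature (s : R) : R := radius^`() s.
Definition equiform_torsion (s : R) : R := radius s * pg_torsion s.

Definition frenet_osculating3 (I : set R) : Prop :=
  forall s, I s ->
    free [:: pg_curve^`(1) s; pg_curve^`(2) s; pg_curve^`(3) s] /\
    ~~ free [:: pg_curve^`(1) s; pg_curve^`(2) s; pg_curve^`(3) s;
                pg_curve^`(4) s].

Local Notation K := equiform_curvature.
Local Notation T := equiform_torsion.

Definition Q2 (s : R) : 'rV[R]_3 :=
  (radius s ^+ 3)^-1 *: (- K s *: equiform_N s + T s *: equiform_B s).

Definition Q3 (sigma : R -> R) (s : R) : 'rV[R]_3 :=
  (radius s ^+ 4)^-1 *:
    ((2 * K s ^+ 2 + T s ^+ 2 - derive_wrt sigma K s) *: equiform_N s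
     + (derive_wrt sigma T s - 3 * K s * T s) *: equiform_B s).

Definition equiform_AW2 (I : set R) (sigma : R -> R) : Prop :=
  forall s, I s ->
    pg_normsq (Q2 s) *: Q3 sigma s = pg_dot (Q3 sigma s) (Q2 s) *: Q2 s.

End PseudoGalileanCurve.

(* Main.v *)
(* For vectors u, v of the isotropic plane x_1 = 0, the vector
   <u,u> v - <v,u> u equals (u_2 v_3 - u_3 v_2) (u_3, u_2), so it vanishes
   exactly when u and v are parallel. The vectors Q_2 and Q_3 lie in this plane,
   spanned by N and B; hence AW(2) says that their coordinates in the basis
   (N, B) are proportional, and the 2x2 determinant of these coordinates is the
   stated expression up to a power of rho. The argument is pointwise in s, with
   K' and T' arbitrary numbers. *)

Require Import Defs.
From mathcomp Require Import all_boot all_order all_algebra.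
From mathcomp Require Import all_classical all_reals all_analysis.
From mathcomp Require Import ring.

Import Order.TTheory GRing.Theory Num.Theory.
Import numFieldNormedType.Exports.

Local Open Scope ring_scope.
Local Open Scope classical_set_scope.

Lemma scale_vec3 (R : realType) (k a b c : R) :
  k *: vec3 a b c = vec3 (k * a) (k * b) (k * c).
Proof. by apply/rowP => -[[|[|[|i]]] Hi] //; rewrite !mxE. Qed.

Lemma add_vec3 (R : realType) (a b c a' b' c' : R) :
  vec3 a b c + vec3 a' b' c' = vec3 (a + a') (b + b') (c + c').
Proof. by apply/rowP => -[[|[|[|i]]] Hi] //; rewrite !mxE. Qed.

Lemma vec3_inj (R : realType) (a b c a' b' c' : R) :
  vec3 a b c = vec3 a' b' c' -> [/\ a = a', b = b' & c = c'].
Proof.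
by move=> /rowP e; split; [have := e 0|have := e 1|have := e 2%:R]; rewrite !mxE.
Qed.

Lemma pg_dot_isotropic (R : realType) (a b c d : R) :
  pg_dot (vec3 0 a b) (vec3 0 c d) = a * c - b * d.
Proof. by rewrite /pg_dot !mxE /= eqxx. Qed.

Lemma isotropic_parallelP (R : realType) (a b c d : R) :
  pg_normsq (vec3 0 a b) *: vec3 0 c d
    = pg_dot (vec3 0 c d) (vec3 0 a b) *: vec3 0 a b
  <-> a * d - b * c = 0.
Proof.
rewrite /pg_normsq !pg_dot_isotropic !scale_vec3.
have id2 : (a * a - b * b) * c - (c * a - d * b) * a = b * (a * d - b * c) by ring.
have id3 : (a * a - b * b) * d - (c * a - d * b) * b = a * (a * d - b * c) by ring.
split => [/vec3_inj[_ e2 e3]|e].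
(* With D = ad - bc, both bD and aD vanish. Passing to D^2 = d(aD) - c(bD) gives D = 0 without a
   case split on u = 0. *)
- apply/eqP; rewrite -sqrf_eq0; apply/eqP.
  transitivity (d * (a * (a * d - b * c)) - c * (b * (a * d - b * c))); first by ring.
  by rewrite -id2 -id3 e2 e3; ring.
- by rewrite e !mulr0 in id2 id3; rewrite !mulr0 (subr0_eq id2) (subr0_eq id3).
Qed.

Section PointwiseCriterion.
Variables (R : realType) (I : set R) (y z sigma : R -> R) (s : R).
Hypotheses (yz_admissible : admissible_on y z I) (Is : I s).

(* [radius] alone would denote the radius of a ball in MathComp-Analysis. *)
Local Notation rho := (Defs.radius y z s).
Local Notation K := (equiform_curvature y z s).
Local Notation T := (equiform_torsion y z s).
Local Notation K' := (derive_wrt sigma (equiform_curvature y z) s).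
Local Notation T' := (derive_wrt sigma (equiform_torsion y z) s).
Local Notation p := (derive1n 2 y s).
Local Notation q := (derive1n 2 z s).

Lemma admissible_sqr_neq0 : p ^+ 2 - q ^+ 2 != 0.
Proof.
have [ne1 ne2] := yz_admissible s Is.
by rewrite subr_eq0 eqf_sqr negb_or; apply/andP; split; apply/eqP.
Qed.

(** As the inverse of 0 is 0, this amounts to a nonzero curvature, which admissibility ensures. *)
Lemma radius_neq0 : rho != 0.
Proof.
by rewrite invr_neq0 // sqrtr_eq0 -ltNge normr_gt0 admissible_sqr_neq0.
Qed.

Lemma pg_sign_neq0 : pg_sign y z s != 0.
Proof. by rewrite sgr_eq0 admissible_sqr_neq0. Qed.

(** One factor [rho] comes from the equiform rescaling, the other from the normalization of
    [frame_e2] and [frame_e3]. *)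
Lemma equiform_NB_comb (a b : R) :
  a *: equiform_N y z s + b *: equiform_B y z s =
  vec3 0 (rho ^+ 2 * (a * p + b * pg_sign y z s * q))
         (rho ^+ 2 * (a * q + b * pg_sign y z s * p)).
Proof.
rewrite /equiform_N /equiform_B /frame_e2 /frame_e3 -/rho.
move: rho (pg_sign y z s) p q => r e p q.
by rewrite !scale_vec3 add_vec3; congr vec3; ring.
Qed.

Lemma equiform_AW2_pointwise :
  pg_normsq (Q2 y z s) *: Q3 y z sigma s
    = pg_dot (Q3 y z sigma s) (Q2 y z s) *: Q2 y z s
  <-> K ^+ 2 * T - K * T' + T * K' - T ^+ 3 = 0.
Proof.
have r0 := radius_neq0; have e0 := pg_sign_neq0; have d0 := admissible_sqr_neq0.
(* The pattern [_^-1] distributes only the powers of [rho]; the outer scalings keep the shape needed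
   by [isotropic_parallelP]. *)
rewrite /Q2 /Q3 !equiform_NB_comb !(scale_vec3 _ (_^-1)) !mulr0.
apply: (iff_trans (isotropic_parallelP _ _ _ _ _)).
move: rho (pg_sign y z s) p q K T K' T' r0 e0 d0.
move=> r e p q K T K' T' r0 e0 d0.
(* The change of basis from (N, B) has determinant r^4 e (p^2 - q^2), and the prefactors of [Q2] and
   [Q3] contribute r^-7. *)
have k0 : r ^- 3 * (e * (p ^+ 2 - q ^+ 2)) != 0.
  by rewrite !mulf_neq0 // invr_neq0 // expf_neq0.
set D := (X in X = 0 <-> _).
have -> : D = r ^- 3 * (e * (p ^+ 2 - q ^+ 2))
              * (K ^+ 2 * T - K * T' + T * K' - T ^+ 3).
  by rewrite /D; field.
by split => [/eqP|->]; rewrite ?mulr0 // mulf_eq0 (negPf k0) => /eqP.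
Qed.

End PointwiseCriterion.

Theorem theorem4p2 (R : realType) (I : set R) (y z sigma : R -> R)
    (I_interval : is_interval I) (I_nondegenerate : I° !=set0)
    (y_smooth : Cn_on 4 I y) (z_smooth : Cn_on 4 I z)
    (yz_admissible : admissible_on y z I)
    (yz_frenet : frenet_osculating3 y z I)
    (sigma_equiform : equiform_parameter y z I sigma) :
  equiform_AW2 y z I sigma <->
  (forall s, I s ->
     let K := equiform_curvature y z in
     let T := equiform_torsion y z in
     let K' := derive_wrt sigma K in
     let T' := derive_wrt sigma T in
     K s ^+ 2 * T s - K s * T' s + T s * K' s - T s ^+ 3 = 0).
Proof.
by split => H s Is; apply/(equiform_AW2_pointwise _ _ _ _ _ _ yz_admissible Is)/H.
Qed.
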